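(* Let $q=p^m$ be a power of a prime $p$ and let $n,r$ be positive integers such that $(m,r)=(mn,r)$, $p\nmid n$ and $(n,p^{(m,r)}-1)=1$. Let $S$ be an $\mathbb{F}_p$-subspace of $\mathbb{F}_q$ of dimension $k\le m$ with a basis $\{\alpha,\alpha^p,\dots,\alpha^{p^{k-1}}\}$. Let $G\in\mathbb{F}_q[x]$ be such that $G(0)\notin S\setminus\{0\}$ and $x(G(x)+b)$ is a permutation polynomial over $\mathbb{F}_q$ for each $b\in S\setminus\{0\}$. For every $i\in\{0,\dots,k-1\}$ let \[\pi_i(x):=x\left(a_ix^{p^r-1}-a_iT_{q^n|q}(x)^{p^r-1}+G(T_{q^n|q}(x))+\alpha^{p^i}\right)\] for some $a_i\in\mathbb{F}_q$, and let $g_i:\mathbb{F}_{q^n}\to\mathbb{F}_{q^n}$ be arbitrary functions. Then $F=(f_0,\dots,f_{k-1}):\mathbb{F}_{q^n}^2\to\mathbb{F}_p^k$, where $f_i(x,y):=T_{q^n|p}(x\pi_i(y)+g_i(y))$, is a $(2mn,k)$-bent function.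
   Context: For $b\mid a$, $T_{Q^a|Q^b}(x)=\sum_{i=0}^{a/b-1}x^{Q^{ib}}$ is the trace. Let $\xi_p=e^{2\pi\sqrt{-1}/p}$. A function $h:\mathbb{F}_{q^n}^2\to\mathbb{F}_p$ (with $\mathbb{F}_{q^n}^2\cong\mathbb{F}_p^{2mn}$) is a $p$-ary bent function if for all $(u,v)\in\mathbb{F}_{q^n}^2$, $\left|\sum_{(x,y)\in\mathbb{F}_{q^n}^2}\xi_p^{h(x,y)+T_{q^n|p}(ux+vy)}\right|=q^n$. A function $F=(f_0,\dots,f_{k-1}):\mathbb{F}_{q^n}^2\to\mathbb{F}_p^k$ is $(2mn,k)$-bent if every nonzero $\mathbb{F}_p$-linear combination of its components is bent. *)

(* Defs.v *)
From HB Require Import structures.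
From mathcomp Require Import all_boot all_order all_algebra all_field.
From mathcomp Require Import reals trigo complex.

Set Implicit Arguments.
Unset Strict Implicit.
Unset Printing Implicit Defensive.

Import GRing.Theory Num.Theory.
Local Open Scope ring_scope.

(* A finite field of characteristic p is a finite extension L of 'F_p, of     *)
(* cardinality p ^ \dim {:L}; its subfields are the K : {subfield L}, and its *)
(* F_p-subspaces are the S : {vspace L}.                                      *)

(* T_{Q^a|Q^b} *)
Definition trace (L : fieldType) (Q a b : nat) (x : L) : L :=
  \sum_(i < a %/ b) x ^+ (Q ^ (i * b)).

(* T_{p^d|p} with values in 'F_p itself, where d = [L : F_p]; trace_FpE shows *)
(* that the default value is never used.                                      *)
Definition trace_Fp (p : nat) (L : fieldExtType 'F_p) (x : L) : 'F_p :=
  odflt 0 [pick c : 'F_p | c%:A == trace p (\dim {:L}) 1 x].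

Lemma trace_FpE (p : nat) (L : fieldExtType 'F_p) (x : L) :
  prime p -> (trace_Fp x)%:A = trace p (\dim {:L}) 1 x.
Proof.
move=> p_pr; rewrite /trace_Fp; case: pickP => [c /eqP //|no_c]; exfalso.
set t := trace _ _ _ _ in no_c.
have cardL : #|{: finvect_type L}| = (p ^ \dim {:L})%N.
  by have := card_vspace (fullv : {vspace finvect_type L}); rewrite card_Fp // => <-;
    apply/esym/eq_card => y; rewrite memvf.
have pL : p \in [pchar L] by rewrite pchar_lalg pchar_Fp.
have tp : t ^+ p = t.
  rewrite -(pFrobenius_autE pL) /t /trace divn1 rmorph_sum /=.
  have : x ^+ (p ^ \dim {:L}) = x.
    by rewrite -cardL; apply: (expf_card (x : finvect_type L)).
  case: (\dim {:L}) => [|d] xd; first by rewrite !big_ord0.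
  rewrite big_ord_recr [RHS]big_ord_recl /= addrC; congr (_ + _).
    by rewrite pFrobenius_autE -exprM muln1 -expnSr xd mul0n expn0 expr1.
  by apply: eq_bigr => i _; rewrite pFrobenius_autE -exprM !muln1 -expnSr.
have := congr1 (map_poly (in_alg L)) (finField_genPoly 'F_p).
rewrite card_Fp // rmorphB /= map_polyXn map_polyX rmorph_prod /=.
move/(congr1 (horner_eval t)); rewrite /horner_eval !hornerE tp subrr.
rewrite horner_prod => /esym/eqP/prodf_eq0[c _].
by rewrite map_polyXsubC !hornerE subr_eq0 eq_sym no_c.
Qed.

Definition xi (R : realType) (p : nat) : R[i] :=
  Complex (cos (2 * pi / p%:R)) (sin (2 * pi / p%:R)).

(* finvect_type L is L with its finite type structure; the exponent is the    *)
(* representative of an element of 'F_p in {0, ..., p - 1}.                   *)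
Definition is_bent (R : realType) (p : nat) (L : fieldExtType 'F_p)
    (h : L * L -> 'F_p) : Prop :=
  forall u v : L,
    `| \sum_(x : finvect_type L) \sum_(y : finvect_type L)
         xi R p ^+ (h (x, y) + trace_Fp (u * (x : L) + v * (y : L)) : 'F_p)%R |
    = (p ^ \dim {:L})%:R.

Definition is_vector_bent (R : realType) (p : nat) (L : fieldExtType 'F_p)
    (N k : nat) (F : L * L -> 'rV['F_p]_k) : Prop :=
  \dim {: (L * L)%type} = N /\
  forall c : 'rV['F_p]_k, c != 0 ->
    is_bent R (fun z => \sum_(i < k) c 0 i * F z 0 i).

Definition permutation_poly (F0 : fieldType) (L : fieldExtType F0)
    (K : {subfield L}) (f : {poly L}) : Prop :=
  [/\ f \is a polyOver K,
      {in K &, injective (horner f)} &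
      forall y, y \in K -> exists2 x, x \in K & f.[x] = y].

(* Main.v *)
Require Import Defs.
From mathcomp Require Import all_boot all_order all_algebra all_field.
From mathcomp Require Import reals trigo complex.
From mathcomp Require Import ring.
Import GRing.Theory Num.Theory Order.TTheory.

Local Open Scope ring_scope.

(* A nonzero combination of the components is Tr(x pi(y) + g(y)) with
   pi(y) = y (A y^(p^r-1) - A T(y)^(p^r-1) + phi(T y)), where A is in K and
   phi = c G + b with b a nonzero element of S; by Maiorana-McFarland it is
   bent as soon as pi is injective. Applying T gives T(pi(y)) = T(y) phi(T y),
   a permutation of K evaluated at T(y), so pi(x) = pi(y) forces T x = T y, and
   z = x - y is then a root of trace 0 of a binomial A z^(p^r) + B z over K.
   If z != 0 this gives z^(p^r-1) in K, which by the gcd conditions puts z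
   itself in K; then n z = T z = 0, a contradiction. When A = 0 the binomial is
   phi(T y) z, and phi has no zero on K because G(0) is not in S minus 0. *)

(** * The root of unity [xi R p] *)

Lemma complex_deMoivre (R : realType) (t : R) n :
  Complex (cos t) (sin t) ^+ n = Complex (cos (t *+ n)) (sin (t *+ n)).
Proof.
elim: n => [|n IHn]; first by rewrite expr0 mulr0n cos0 sin0.
by rewrite exprS IHn mulrS cosD sinD /GRing.mul /= addrC [sin t * _ + _]addrC.
Qed.

Lemma xi_expp (R : realType) p : (0 < p)%N -> xi R p ^+ p = 1.
Proof.
move=> p_gt0; rewrite /xi complex_deMoivre -[_ *+ p]mulr_natr.
rewrite divfK ?pnatr_eq0 -?lt0n // mulr_natl.
by rewrite -[pi *+ 2]add0r cosD2pi sinD2pi cos0 sin0.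
Qed.

(** The real part is [1 - 2 * sin (pi / p) ^+ 2], and the sine is positive because [pi / p] lies
    strictly between [0] and [pi]. *)
Lemma xi_neq1 (R : realType) p : (1 < p)%N -> xi R p != 1.
Proof.
move=> p_gt1; rewrite eq_complex /= negb_and; apply/orP; left.
have p_gt0 : 0 < p%:R :> R by rewrite ltr0n ltnW.
have -> : 2 * pi / p%:R = (pi / p%:R) *+ 2 :> R by rewrite -mulrA mulr_natl.
rewrite cos_mulr2n cos2sin2.
have s_gt0 : 0 < sin (pi / p%:R : R).
  apply: sin_gt0_pi; rewrite divr_gt0 ?pi_gt0 //=.
  by rewrite ltr_pdivrMr // ltr_pMr ?pi_gt0 // ltr1n.
rewrite -subr_eq0 -addrA -opprD -[1 + 1]mulr2n -mulrnBl mulrn_eq0 /=.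
by rewrite addrAC subrr add0r oppr_eq0 expf_neq0 ?gt_eqF.
Qed.

Lemma norm_xi (R : realType) p : (0 < p)%N -> `|xi R p| = 1.
Proof.
move=> p_gt0; apply/eqP; rewrite -(@pexpr_eq1 _ _ p) //.
by rewrite -normrX xi_expp ?normr1.
Qed.


(** * Iterated Frobenius maps and their fixed points *)

Lemma expr_pX_additive (p : nat) (L : fieldType) (s : nat) :
  p \in [pchar L] -> {morph (fun x : L => x ^+ (p ^ s)) : x y / x + y}.
Proof.
move=> pL x y; elim: s => [|s IHs]; first by rewrite !expr1.
by rewrite !expnSr !exprM IHs -!(pFrobenius_autE pL) rmorphD.
Qed.

Lemma expr_pX_sum (p : nat) (L : fieldType) (s : nat) (I : finType)
    (F : I -> L) : p \in [pchar L] ->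
  (\sum_i F i) ^+ (p ^ s) = \sum_i F i ^+ (p ^ s).
Proof.
move=> pL; apply: (big_morph (fun x => x ^+ (p ^ s))).
  exact: expr_pX_additive.
by rewrite expr0n -leqn0 leqNgt expn_gt0 (prime_gt0 (pcharf_prime pL)).
Qed.

Lemma expr_fixX (L : pzSemiRingType) (x : L) Q j :
  x ^+ Q = x -> x ^+ (Q ^ j) = x.
Proof.
by move=> xQ; elim: j => [|j IHj]; rewrite ?expr1 // expnSr exprM IHj.
Qed.

(** By Bezout some [gcdn a b + j * b] is a multiple of [a], so that power of Frobenius fixes [x],
    and its [j * b] part fixes [x] as well. *)
Lemma expr_fix_gcd (L : pzSemiRingType) (p a b : nat) (x : L) : (0 < a)%N ->
  x ^+ (p ^ a) = x -> x ^+ (p ^ b) = x -> x ^+ (p ^ gcdn a b) = x.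
Proof.
move=> a_gt0 xa xb; have [j _ /dvdnP[k Ejk]] := Bezoutl b a_gt0.
have : x ^+ (p ^ (gcdn a b + j * b)) = x.
  by rewrite Ejk mulnC expnM expr_fixX.
by rewrite addnC expnD exprM mulnC expnM (expr_fixX _ _ _ _ xb).
Qed.

Lemma expr_fix_subn1 (L : idomainType) (x : L) Q : (0 < Q)%N -> x != 0 ->
  (x ^+ (Q - 1) == 1) = (x ^+ Q == x).
Proof.
case: Q => // Q _ x_neq0; rewrite subn1 /= exprS -{4}[x]mulr1.
by rewrite (inj_eq (mulfI x_neq0)).
Qed.

Lemma expr_coprime_eq1 (L : pzSemiRingType) (x : L) a b : (0 < a)%N ->
  coprime a b -> x ^+ a = 1 -> x ^+ b = 1 -> x = 1.
Proof.
move=> a_gt0 /eqP cop_ab xa xb; have [j _] := Bezoutl b a_gt0.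
move=> /(expr_dvd xa); rewrite cop_ab exprD expr1 mulnC exprM xb expr1n mulr1.
by [].
Qed.

(** * Linearity and surjectivity of the trace *)

Section Trace.

Variables (p : nat) (L : fieldExtType 'F_p).
Hypothesis p_prime : prime p.

Lemma pchar_fieldExt_Fp : p \in [pchar L].
Proof. by rewrite pchar_lalg pchar_Fp. Qed.

Local Notation pL := pchar_fieldExt_Fp.

Lemma traceE Q d (x : L) : trace Q d 1 x = \sum_(i < d) x ^+ (Q ^ i).
Proof.
by rewrite /trace divn1; apply: eq_bigr => i _; rewrite muln1.
Qed.

Lemma traceD s d : {morph @trace L (p ^ s) d 1 : x y / x + y}.
Proof.
move=> x y; rewrite !traceE -big_split; apply: eq_bigr => i _ /=.
by rewrite -expnM; apply: expr_pX_additive pL _ _.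
Qed.

Lemma traceM Q d (c x : L) :
  c ^+ Q = c -> trace Q d 1 (c * x) = c * trace Q d 1 x.
Proof.
move=> cQ; rewrite !traceE mulr_sumr; apply: eq_bigr => i _.
by rewrite exprMn expr_fixX.
Qed.

Lemma trace_expr_pX s d j (x : L) :
  trace (p ^ s) d 1 (x ^+ (p ^ j)) = trace (p ^ s) d 1 x ^+ (p ^ j).
Proof.
rewrite !traceE expr_pX_sum ?pL //; apply: eq_bigr => i _.
by rewrite -!exprM mulnC.
Qed.

Lemma in_alg_expp (c : 'F_p) : (c%:A : L) ^+ p = c%:A.
Proof.
have cp : c ^+ p = c by have := expf_card c; rewrite card_Fp.
by rewrite -{2}cp -!in_algE rmorphXn.
Qed.

Lemma mem_subfield_expr (K : {subfield L}) (x : L) :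
  (x \in K) = (x ^+ (p ^ \dim K) == x).
Proof. by rewrite Fermat's_little_theorem card_Fp. Qed.

Lemma expr_dimf (x : L) : x ^+ (p ^ \dim {:L}) = x.
Proof. by apply/eqP; rewrite -mem_subfield_expr memvf. Qed.

Lemma card_finvect : #|{: finvect_type L}| = (p ^ \dim {:L})%N.
Proof.
have := card_vspace (fullv : {vspace finvect_type L}); rewrite card_Fp // => <-.
by apply/esym/eq_card => y; rewrite memvf.
Qed.

Lemma trace_Fp_is_additive : {morph @trace_Fp p L : x y / x + y}.
Proof.
move=> x y; apply: (fmorph_inj (in_alg L)).
rewrite rmorphD /= !trace_FpE //.
exact: (traceD 1).
Qed.

Lemma trace_FpZ (c : 'F_p) (x : L) : trace_Fp (c *: x) = c * trace_Fp x.
Proof.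
apply: (fmorph_inj (in_alg L)).
rewrite rmorphM /= !trace_FpE // -[c *: x]mulr_algl.
by rewrite (traceM p) ?in_alg_expp.
Qed.

Lemma trace_Fp_sum (I : finType) (F : I -> L) :
  trace_Fp (\sum_i F i) = \sum_i trace_Fp (F i).
Proof.
apply: (big_morph _ trace_Fp_is_additive).
by rewrite -[X in trace_Fp X](scale0r (0 : L)) trace_FpZ mul0r.
Qed.

(** One nonzero value suffices, by scaling. If all values were zero, a nonzero polynomial of degree
    below [p ^ d] would have all [p ^ d] field elements as roots. *)
Lemma trace_Fp_onto (c : 'F_p) : exists x : L, trace_Fp x = c.
Proof.
suff [x x_neq0] : exists x : finvect_type L, trace_Fp (x : L) != 0.
  by exists (c / trace_Fp (x : L) *: (x : L)); rewrite trace_FpZ divfK.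
apply/existsP; rewrite -[X in is_true X]negbK; apply/negP.
rewrite negb_exists => /forallP trace0.
set d := \dim {:L}.
have d_gt0 : (0 < d)%N by rewrite adim_gt0.
pose P : {poly finvect_type L} := \sum_(i < d) 'X^(p ^ i).
have p_gt1 := prime_gt1 p_prime.
have P_neq0 : P != 0.
  (* The coefficient of ['X] is [1]: only [i = 0] contributes to it. *)
  apply/eqP => /(congr1 (fun Q : {poly _} => Q`_1)) /eqP.
  rewrite coef0 coef_sum (bigD1 (Ordinal d_gt0)) //= coefXn eqxx.
  rewrite big1 ?addr0 ?oner_eq0 // => i i_neq0.
  rewrite coefXn -[X in X == _](expn0 p) eqn_exp2l // eq_sym.
  by rewrite (negPf (_ : (i : nat) != 0%N)).
have sizeP : (size P <= p ^ d)%N.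
  apply: leq_trans (size_sum _ _ _) _; apply/bigmax_leqP => i _.
  by rewrite size_polyXn ltn_exp2l.
suff : (size (enum (finvect_type L)) < size P)%N.
  by rewrite -cardE card_finvect ltnNge sizeP.
apply: max_poly_roots P_neq0 _ (enum_uniq _); apply/allP => x _.
have /negPn/eqP tr0 : ~~ (trace_Fp (x : L) != 0) := trace0 x.
have := @trace_FpE p L x p_prime; rewrite tr0 scale0r traceE => Ex.
rewrite rootE horner_sum; apply/eqP/esym.
by rewrite [LHS]Ex; apply: eq_bigr => i _; rewrite hornerXn.
Qed.

End Trace.

(** * Injectivity of the perturbed linearized maps *)

Section Permutation.

Variables (p m n r : nat) (L : fieldExtType 'F_p) (K : {subfield L}).
Hypotheses (p_prime : prime p) (m_gt0 : (0 < m)%N) (n_gt0 : (0 < n)%N).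
Hypotheses (dimK : \dim K = m) (dimL : \dim {:L} = (m * n)%N).

Local Notation T := (@trace L (p ^ m) n 1).
Local Notation pL := (pchar_fieldExt_Fp p L p_prime).

Lemma memK_expr (x : L) : (x \in K) = (x ^+ (p ^ m) == x).
Proof. by rewrite (mem_subfield_expr _ _ p_prime) dimK. Qed.

(** Raising to the power [p ^ m] shifts the summands cyclically; the last one returns to [x]. *)
Lemma relative_trace_mem (x : L) : T x \in K.
Proof.
rewrite memK_expr !traceE (expr_pX_sum _ _ _ _ _ pL); apply/eqP.
case: n n_gt0 dimL => // d _ dimLd.
rewrite big_ord_recr [RHS]big_ord_recl /= addrC; congr (_ + _).
  by rewrite -exprM -expnSr -expnM -dimLd expr_dimf.
by apply: eq_bigr => i _; rewrite -exprM -expnSr.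
Qed.

Lemma relative_traceM (c x : L) : c \in K -> T (c * x) = c * T x.
Proof. by rewrite memK_expr => /eqP cK; apply: traceM. Qed.

Hypotheses (gcd_mr : gcdn m r = gcdn (m * n) r) (p_ndvd_n : ~~ (p %| n)%N).
Hypothesis cop_n : coprime n (p ^ gcdn m r - 1).

(* [u = z ^+ (q - 1)] lies in the field with [p ^ gcdn m r] elements, which is
   contained in [K], so its norm to [K] is [u ^+ n]; this norm is [1]. *)
Lemma mem_expr_subn1 (z : L) : z != 0 -> z ^+ (p ^ r - 1) \in K -> z \in K.
Proof.
move=> z_neq0 wK; pose u := z ^+ (p ^ m - 1).
have pX_gt0 j : (0 < p ^ j)%N by rewrite expn_gt0 prime_gt0.
have u_neq0 : u != 0 by rewrite expf_neq0.
(* [u ^+ (p ^ r - 1)] is the [(p ^ m - 1)]-th power of a nonzero element of [K]. *)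
have ur : u ^+ (p ^ r) = u.
  apply/eqP; rewrite -expr_fix_subn1 // -exprM mulnC exprM.
  by rewrite expr_fix_subn1 ?expf_neq0 // -memK_expr.
have ug : u ^+ (p ^ gcdn m r) = u.
  rewrite gcd_mr; apply: expr_fix_gcd ur; first by rewrite muln_gt0 m_gt0.
  by rewrite -dimL expr_dimf.
have um : u ^+ (p ^ m) = u.
  by have /dvdnP[j ->] := dvdn_gcdl m r; rewrite mulnC expnM expr_fixX.
have un : u ^+ n = 1.
  have : z ^+ (p ^ (m * n) - 1) == 1.
    by rewrite expr_fix_subn1 // -dimL expr_dimf.
  rewrite expnM subn1 predn_exp exprM -subn1 -/u -prodrXr => /eqP <-.
  rewrite (eq_bigr (fun=> u)) => [|i _]; first by rewrite prodr_const card_ord.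
  exact: expr_fixX.
have u1 : u = 1.
  apply: expr_coprime_eq1 cop_n un _ => //.
  by apply/eqP; rewrite expr_fix_subn1 ?ug.
by rewrite memK_expr -expr_fix_subn1 // -/u u1.
Qed.

(** On [K] the trace is multiplication by [n], which is invertible in characteristic [p]. *)
Lemma relative_trace_eq0 (z : L) : z \in K -> T z = 0 -> z = 0.
Proof.
move=> zK; rewrite -[z]mulr1 relative_traceM // => /eqP.
rewrite mulf_eq0 mulr1 traceE => /orP[/eqP //|].
rewrite (eq_bigr (fun=> 1)) => [|i _]; last by rewrite expr1n.
by rewrite sumr_const card_ord -(dvdn_pcharf pL) (negPf p_ndvd_n).
Qed.

Lemma linearized_perturbation_inj (A : L) (phi : L -> L) : A \in K ->
  {in K, forall t, phi t \in K} -> phi 0 != 0 ->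
  {in K &, injective (fun t => t * phi t)} ->
  injective (fun x => x * (A * x ^+ (p ^ r - 1) - A * T x ^+ (p ^ r - 1)
                           + phi (T x))).
Proof.
move=> AK phiK phi0 phi_inj.
have pr_gt0 : (0 < p ^ r)%N by rewrite expn_gt0 prime_gt0.
have mulX (x : L) : x * x ^+ (p ^ r - 1) = x ^+ (p ^ r).
  by rewrite -exprS subn1 prednK.
(* A zero of [phi] at [t != 0] would give [t * phi t] the value it already takes at [0]. *)
have phi_neq0 t : t \in K -> phi t != 0.
  move=> tK; have [->//|t_neq0] := eqVneq t 0.
  apply: contra_neq t_neq0 => phit0; apply: phi_inj => //; first exact: rpred0.
  by rewrite phit0 mulr0 mul0r.
(* For a fixed value of [T x] the map becomes an additive binomial in [x] with coefficients in
   [K]. *)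
pose B t := phi t - A * t ^+ (p ^ r - 1).
have BK t : t \in K -> B t \in K.
  by move=> tK; rewrite rpredB ?rpredM ?rpredX ?phiK.
have piE x : x * (A * x ^+ (p ^ r - 1) - A * T x ^+ (p ^ r - 1) + phi (T x))
           = A * x ^+ (p ^ r) + B (T x) * x.
  by rewrite -mulX /B; ring.
(* [T] is [K]-linear and commutes with Frobenius, so the two terms in [A] cancel. *)
have TpiE x : T (A * x ^+ (p ^ r) + B (T x) * x) = T x * phi (T x).
  rewrite (traceD _ _ p_prime) !relative_traceM ?BK ?relative_trace_mem //.
  rewrite (trace_expr_pX _ _ p_prime) -mulX /B; ring.
move=> x y; rewrite !piE => Exy.
have Txy : T x = T y.
  by apply: phi_inj; rewrite ?relative_trace_mem // -!TpiE Exy.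
apply/eqP; rewrite -subr_eq0; set z := x - y.
have Tz : T z = 0.
  by apply: (addIr (T y)); rewrite -(traceD _ _ p_prime) subrK add0r.
have Az : A * z ^+ (p ^ r) + B (T y) * z = 0.
  apply: (addIr (A * y ^+ (p ^ r) + B (T y) * y)).
  rewrite add0r addrACA -!mulrDr subrK.
  rewrite -(expr_pX_additive _ _ _ pL) subrK.
  by rewrite -{1}Txy Exy.
apply/eqP; have [//|z_neq0] := eqVneq z 0; apply: relative_trace_eq0 Tz.
have Aw : A * z ^+ (p ^ r - 1) + B (T y) = 0.
  by apply: (mulfI z_neq0); rewrite mulr0 mulrDr mulrCA mulX [z * _]mulrC.
have [A0|A_neq0] := eqVneq A 0.
  move/eqP: Aw; rewrite /B A0 !mul0r subr0 add0r (negPf (phi_neq0 _ _)) //.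
  exact: relative_trace_mem.
apply: mem_expr_subn1 z_neq0 _.
have -> : z ^+ (p ^ r - 1) = A^-1 * - B (T y).
  by apply: (mulfI A_neq0); rewrite mulVKf //; apply/eqP; rewrite -addr_eq0 Aw.
by rewrite rpredM ?rpredV ?rpredN ?BK ?relative_trace_mem.
Qed.

End Permutation.

(** * Additive characters and bent functions *)

Section Bent.

Variables (R : realType) (p : nat) (L : fieldExtType 'F_p).
Hypothesis p_prime : prime p.

Local Notation chi x := (xi R p ^+ (trace_Fp (x : L) : 'F_p)).

Lemma xi_expD (c d : 'F_p) :
  xi R p ^+ (c + d)%R = xi R p ^+ c * xi R p ^+ d.
Proof.
rewrite -exprD -[RHS](expr_mod _ (xi_expp R p (prime_gt0 p_prime))).
(* Addition in ['F_p] reduces modulo the modulus built into the type, which equals [p] for [p]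
   prime. *)
by congr (_ ^+ (_ %% _)); apply: Fp_cast.
Qed.

(** Translating [x] by [t / w], with [t] of trace [1], permutes the summands and multiplies the sum
    by [xi R p != 1]. *)
Lemma sum_chi_eq0 (w : L) : w != 0 ->
  \sum_(x : finvect_type L) chi ((x : L) * w) = 0.
Proof.
move=> w_neq0; have [t tr_t] := trace_Fp_onto p L p_prime 1.
set s := \sum_x _.
have s_eq : s = s * xi R p.
  rewrite {1}/s mulr_suml (reindex_inj (addIr (t / w : finvect_type L))) /=.
  apply: eq_bigr => x _.
  have -> : ((x + (t / w : finvect_type L))%R : L) * w = (x : L) * w + t.
    by rewrite [LHS]mulrDl divfK.
  rewrite trace_Fp_is_additive // tr_t xi_expD; congr (_ * _).
have /eqP : s * (xi R p - 1) = 0 by rewrite mulrBr mulr1 -s_eq subrr.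
rewrite mulf_eq0 subr_eq0 (negPf (xi_neq1 _ _ (prime_gt1 p_prime))) orbF.
by move/eqP.
Qed.

Lemma is_bent_eq (h h' : L * L -> 'F_p) :
  h =1 h' -> is_bent R h -> is_bent R h'.
Proof.
move=> eq_h bent_h u v; rewrite -(bent_h u v); congr `|_|.
by apply: eq_bigr => x _; apply: eq_bigr => y _; rewrite eq_h.
Qed.

(* Maiorana-McFarland construction: summing over [x] first kills every [y]
   except the one with [pi_ y = - u]. *)
Lemma maiorana_mcfarland_bent (pi_ g : L -> L) : injective pi_ ->
  is_bent R (fun z => trace_Fp (z.1 * pi_ z.2 + g z.2)).
Proof.
move=> pi_inj u v; rewrite exchange_big /=.
have [pi' _ piK] : bijective (pi_ : finvect_type L -> finvect_type L).
  exact: injF_bij.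
pose y0 : finvect_type L := pi' (- u : L).
have sumE (y : finvect_type L) :
    \sum_(x : finvect_type L) xi R p ^+
       (trace_Fp ((x : L) * pi_ y + g y)
        + trace_Fp (u * (x : L) + v * (y : L)))%R
    = (\sum_(x : finvect_type L) chi ((x : L) * (pi_ y + u)))
      * chi (g y + v * (y : L)).
  rewrite mulr_suml; apply: eq_bigr => x _.
  rewrite -xi_expD -!trace_Fp_is_additive //; congr (_ ^+ trace_Fp _).
  by rewrite mulrDr [u * _]mulrC addrACA.
rewrite (eq_bigr _ (fun y _ => sumE y)) (bigD1 y0) //=.
rewrite [X in _ + X]big1 => [|y y_neq0].
  have pi_y0 : pi_ y0 = - u := piK _.
  rewrite pi_y0 addNr.
  have trace0 : trace_Fp (0 : L) = 0.
    by rewrite -[0 in LHS](scale0r (0 : L)) trace_FpZ // mul0r.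
  (* At [y0] the inner character is trivial, leaving the field cardinality times a number of norm
     [1]. *)
  rewrite addr0 (eq_bigr (fun=> 1)) => [|x _]; last by rewrite mulr0 trace0.
  rewrite sumr_const cardT -cardE card_finvect // normrM normrX.
  by rewrite norm_xi ?prime_gt0 // expr1n mulr1 normr_nat.
rewrite sum_chi_eq0 ?mul0r // addr_eq0; apply: contra y_neq0 => /eqP Ey.
by apply/eqP/pi_inj; rewrite Ey; apply/esym/piK.
Qed.

End Bent.

(** * Combining the components *)

Theorem theorem6p2 (R : realType) (p m n r k : nat)
    (p_prime : prime p) (m_gt0 : (0 < m)%N) (n_gt0 : (0 < n)%N)
    (r_gt0 : (0 < r)%N)
    (L : fieldExtType 'F_p) (K : {subfield L})
    (dimK : \dim K = m) (dimL : \dim {:L} = (m * n)%N)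
    (gcd_mr : gcdn m r = gcdn (m * n) r)
    (p_ndvd_n : ~~ (p %| n)%N)
    (cop_n : coprime n (p ^ gcdn m r - 1))
    (S : {vspace L}) (S_sub : (S <= K)%VS)
    (dimS : \dim S = k) (k_le_m : (k <= m)%N)
    (alpha : L)
    (basisS : basis_of S [seq alpha ^+ (p ^ i) | i <- iota 0 k])
    (G : {poly L}) (G_over : G \is a polyOver K)
    (G0 : ~~ ((G.[0] \in S) && (G.[0] != 0)))
    (G_perm : forall b : L, b \in S -> b != 0 ->
       permutation_poly K ('X * (G + b%:P)))
    (a : 'I_k -> L) (a_in : forall i, a i \in K)
    (g : 'I_k -> L -> L) :
  let T := trace (p ^ m) n 1 in
  let pi_ (i : 'I_k) (x : L) : L :=
    x * (a i * x ^+ (p ^ r - 1) - a i * T x ^+ (p ^ r - 1)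
         + G.[T x] + alpha ^+ (p ^ i)) in
  let f (i : 'I_k) (z : L * L) : 'F_p :=
    trace_Fp (z.1 * pi_ i z.2 + g i z.2) in
  is_vector_bent R (2 * (m * n)) (fun z => \row_(i < k) f i z).
Proof.
move=> T pi_ f; split=> [|c c_neq0].
  have := dimL; rewrite !dimvf => dimL'.
  by rewrite mul2n -addnn -[in RHS]dimL'.
have alpha_nth (i : 'I_k) :
    [seq alpha ^+ (p ^ j) | j <- iota 0 k]`_i = alpha ^+ (p ^ i).
  by rewrite (nth_map 0%N) ?size_iota // nth_iota.
(* Summing the components with weights [c] turns [a i], [G] and the powers of [alpha] into [A],
   [C *: G] and [b]. *)
pose A := \sum_i c 0 i *: a i; pose C := \sum_i c 0 i.
pose b := \sum_i c 0 i *: alpha ^+ (p ^ i).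
have bS : b \in S.
  apply: rpred_sum => i _; apply/rpredZ/(basis_mem basisS)/mapP.
  by exists (i : nat); rewrite ?mem_iota ?ltn_ord.
(* The entries of [c] are the coordinates of [b] in the basis of [S]. *)
have b_neq0 : b != 0.
  apply: contra_neq c_neq0 => b0; apply/rowP => i; rewrite mxE.
  have size_s : size [seq alpha ^+ (p ^ j) | j <- iota 0 k] == k.
    by rewrite size_map size_iota.
  apply: (elimT (@freeP _ _ _ (Tuple size_s)) (basis_free basisS)).
  by rewrite -[RHS]b0; apply: eq_bigr => j _; rewrite /= alpha_nth.
pose phi t := C *: G.[t] + b.
have bK := subvP S_sub b bS.
have G0_neq b' : b' \in S -> b' != 0 -> G.[0] != b'.
  by move=> b'S b'_neq0; apply: contraNneq G0 => ->; rewrite b'S.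
have phi0 : phi 0 != 0.
  rewrite /phi; have [->|C_neq0] := eqVneq C 0; first by rewrite scale0r add0r.
  (* If [phi 0] vanished, [G.[0]] would be this nonzero element of [S]. *)
  have : G.[0] != - (C^-1 *: b).
    apply: G0_neq; rewrite ?rpredN ?rpredZ // oppr_eq0 scaler_eq0 invr_eq0.
    by rewrite negb_or C_neq0.
  apply: contra_neq => /eqP; rewrite addr_eq0 => /eqP Gb.
  by rewrite -scalerN -Gb scalerA mulVf ?scale1r.
have phi_inj : {in K &, injective (fun t => t * phi t)}.
  move=> s t sK tK /=; rewrite /phi.
  (* For [C = 0] the map is multiplication by [b]; otherwise it is [C] times the permutation
     polynomial attached to [C^-1 *: b]. *)
  have [->|C_neq0] := eqVneq C 0.
    by rewrite !scale0r !add0r => /(mulIf b_neq0).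
  have [] := G_perm (C^-1 *: b).
  - exact: rpredZ.
  - by rewrite scaler_eq0 invr_eq0 negb_or C_neq0.
  move=> _ G_inj _ Est; apply: G_inj => //; rewrite !hornerE.
  apply: (scalerI C_neq0).
  by rewrite !scalerAr !scalerDr scalerA mulfV // scale1r.
apply: (@is_bent_eq R p L (fun z => trace_Fp
  (z.1 * (z.2 * (A * z.2 ^+ (p ^ r - 1) - A * T z.2 ^+ (p ^ r - 1)
                 + phi (T z.2)))
   + \sum_i c 0 i *: g i z.2))).
  move=> z; under [RHS]eq_bigr => i _ do rewrite mxE /f -trace_FpZ //.
  rewrite -trace_Fp_sum //; congr trace_Fp.
  under [RHS]eq_bigr => i _ do rewrite scalerDr scalerAr.
  rewrite big_split -mulr_sumr /=; congr (_ * _ + _).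
  rewrite /pi_; under [RHS]eq_bigr => i _ do rewrite scalerAr !scalerDr scalerN.
  rewrite -mulr_sumr !big_split /= sumrN -scaler_suml -/b -addrA.
  rewrite /A !mulr_suml; congr (_ * (_ - _ + _));
    by apply: eq_bigr => i _; rewrite scalerAl.
apply: (maiorana_mcfarland_bent R p L p_prime (fun y => y *
  (A * y ^+ (p ^ r - 1) - A * T y ^+ (p ^ r - 1) + phi (T y)))
  (fun y => \sum_i c 0 i *: g i y)).
apply: (linearized_perturbation_inj p m n r L K) => //.
- by apply: rpred_sum => i _; rewrite rpredZ ?a_in.
- by move=> t tK; rewrite rpredD ?rpredZ ?rpred_horner.
Qed.
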